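(* Let $P$ be a poset. The inclusion map $\delta\colon P\hookrightarrow G(P)$ is a fusion-completion of $P$.
   Context: In a poset $P$, $x\circ y$ (overlap) means that there is $z\in P$ with $z\le x$ and $z\le y$. For $x\in P$ let $\mathsf{O}(x)=\{y\in P\mid x\circ y\}$, and for $A\subseteq P$ let $\mathsf{O}(A)=\bigcup\{\mathsf{O}(x)\mid x\in A\}$. For $\varnothing\ne A\subseteq P$, an element $x\in P$ is a fusion of $A$ if for every $y\in P$: $y\circ x$ if and only if $y\circ z$ for some $z\in A$. A poset is fusion-complete if every nonempty subset has a fusion. An order-embedding is a map $f$ with $x\le y\iff f(x)\le f(y)$. A map $f\colon P\to M$ is: $\circ$-reflecting if $f(x)\circ f(y)$ implies $x\circ y$; fusion-preserving if $f(x)$ is a fusion of $f(A)$ in $M$ whenever $x\in P$ is a fusion of $A\subseteq P$; fusion-dense if for every $m\in M$ there is $A\subseteq P$ such that $m$ is a fusion of $f(A)$ in $M$. A fusion-completion of $P$ is a fusion-complete poset $M$ together with a $\circ$-reflecting, fusion-preserving and fusion-dense order-embedding $e\colon P\to M$. $G(P)$ is the set $P\cup\{f_{\mathsf{O}(A)}\mid \varnothing\neq A\subseteq P\text{ has no fusion in }P\}$, where the $f_{\mathsf{O}(A)}$ are new formal elements not in $P$, indexed by the sets $\mathsf{O}(A)$ (so $f_{\mathsf{O}(A)}=f_{\mathsf{O}(B)}$ iff $\mathsf{O}(A)=\mathsf{O}(B)$). Its order is: on $P$ the given order; each $f_{\mathsf{O}(A)}\le f_{\mathsf{O}(A)}$;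 for $x\in P$, $x\le f_{\mathsf{O}(A)}$ iff $\mathsf{O}(x)\subseteq\mathsf{O}(A)$; distinct new elements are incomparable; and no new element is below an element of $P$. *)

(* Defs.v *)
From HB Require Import structures.
From mathcomp Require Import all_boot all_order.
From mathcomp Require Import boolp classical_sets.

Set Implicit Arguments.
Unset Strict Implicit.
Unset Printing Implicit Defensive.

Import Order.TTheory.
Local Open Scope classical_set_scope.
Local Open Scope order_scope.

Section Fusion.
Context {d : Order.disp_t} {P : porderType d}.
Implicit Types (x y z : P) (A : set P).

Definition overlap x y : Prop := exists z, z <= x /\ z <= y.

Definition overlaps x : set P := [set y | overlap x y].

Definition overlaps_set A : set P := \bigcup_(x in A) overlaps x.

Definition is_fusion A x : Prop :=
  A !=set0 /\ forall y, overlap y x <-> exists2 z, A z & overlap y z.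

End Fusion.

Definition fusion_complete d (P : porderType d) : Prop :=
  forall A : set P, A !=set0 -> exists x, is_fusion A x.

Section Maps.
Context {d d' : Order.disp_t} {P : porderType d} {M : porderType d'}.
Implicit Type f : P -> M.

Definition order_embedding f : Prop :=
  forall x y, x <= y <-> f x <= f y.

Definition overlap_reflecting f : Prop :=
  forall x y, overlap (f x) (f y) -> overlap x y.

Definition fusion_preserving f : Prop :=
  forall (A : set P) x, is_fusion A x -> is_fusion (f @` A) (f x).

Definition fusion_dense f : Prop :=
  forall m, exists A : set P, is_fusion (f @` A) m.

Definition fusion_completion f : Prop :=
  [/\ fusion_complete M, order_embedding f, overlap_reflecting f,
      fusion_preserving f & fusion_dense f].

End Maps.

Section G.
Context {d : Order.disp_t} (P : porderType d).

(* The indices O(A) of the new elements f_{O(A)}; as these are sets, new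
   elements with the same O(A) are identified. *)
Definition new_index : set (set P) :=
  [set overlaps_set A | A in
    [set A : set P | A !=set0 /\ ~ exists x, is_fusion A x]].

(* [inr s] is the new element f_s. *)
Definition G : Type := (P + set_type new_index)%type.

HB.instance Definition _ := Choice.on G.

Definition leG (a b : G) : bool :=
  match a, b with
  | inl x, inl y => x <= y
  | inl x, inr s => `[< overlaps x `<=` val s >]
  | inr _, inl _ => false
  | inr s, inr t => s == t
  end.

Lemma leG_refl : reflexive leG.
Proof. by case=> [x|s] /=. Qed.

Lemma leG_anti : antisymmetric leG.
Proof.
case=> [x|s] [y|t] /=; rewrite ?andbF //.
- by move/le_anti->.
- by case/andP=> /eqP->.
Qed.

Lemma leG_trans : transitive leG.
Proof.
case=> [y|t] [x|s] [z|u] //=.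
- exact: le_trans.
- move=> xy /asboolP yu; apply/asboolP => w [v [vx vw]].
  by apply: yu; exists v; split=> //; apply: le_trans xy.
- by move=> xt /eqP<-.
- by move=> /eqP->.
Qed.

HB.instance Definition _ :=
  Order.Le_isPOrder.Build d G leG_refl leG_anti leG_trans.

Definition delta : P -> G := inl.

End G.

Arguments delta {d} P _.

(* Main.v *)
Require Import Defs.
From mathcomp Require Import all_boot all_order.
From mathcomp Require Import boolp classical_sets.

(** Every element of [G P] lies above an element of [P] ([delta_below]), so
    overlap in [G P] is detected by [P] ([overlap_below]): each [m] is
    described, as far as overlap goes, by its trace, the set of elements of [P]
    that overlap it.  The trace of [x] in [P] is [O(x)], and the trace of
    [f_O(A)] is [O(A)] ([overlap_delta_inl], [overlap_delta_inr]).  Therefore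
    [m] is a fusion of a nonempty [S] in [G P] exactly when the trace of [m] is
    the union of the traces of the members of [S] (the useful half is
    [fusion_of_trace]).

    If [S] is nonempty and [B] is the set of elements of [P] below some member
    of [S], that union is [O(B)].  It is the trace of a fusion of [B] in [P] if
    there is one, and of the new element [f_O(B)] otherwise; hence [G P] is
    fusion-complete.  The same criterion shows that [delta] preserves fusions
    and that every [m] is the fusion of the elements of [P] below it. *)

Set Implicit Arguments.
Unset Strict Implicit.
Unset Printing Implicit Defensive.

Import Order.TTheory.
Local Open Scope classical_set_scope.
Local Open Scope order_scope.

Section Overlap.
Context {d : Order.disp_t} {P : porderType d}.
Implicit Types x y z : P.

Lemma overlap_refl x : overlap x x.
Proof. by exists x; split. Qed.

Lemma overlap_sym x y : overlap x y -> overlap y x.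
Proof. by case=> z [zx zy]; exists z; split. Qed.

Lemma overlap_ler x y z : y <= z -> overlap x y -> overlap x z.
Proof.
by move=> yz [w [wx wy]]; exists w; split=> //; apply: le_trans yz.
Qed.

Lemma overlap_lel x y z : x <= z -> overlap x y -> overlap z y.
Proof. by move=> xz /overlap_sym/(overlap_ler xz)/overlap_sym. Qed.

End Overlap.

Section Completion.
Context {d : Order.disp_t} {P : porderType d}.
Implicit Types (x y z p q : P) (A : set P) (m u v : G P) (S : set (G P)).

Lemma le_delta x y : (delta P x <= delta P y) = (x <= y).
Proof. by []. Qed.

Lemma le_delta_inr x (s : set_type (@new_index d P)) :
  delta P x <= (inr s : G P) <-> overlaps x `<=` val s.
Proof. by split=> [/asboolP|/asboolP]. Qed.

Lemma delta_below m : exists p, delta P p <= m.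
Proof.
case: m => [x|s]; first by exists x; rewrite le_delta.
have := set_valP s; case=> A [[a Aa] _] As; exists a.
by apply/le_delta_inr; rewrite -As => y ay; exists a.
Qed.

Lemma overlap_below u v :
  overlap u v <-> exists p, delta P p <= u /\ delta P p <= v.
Proof.
split=> [[w [wu wv]]|[p puv]]; last by exists (delta P p).
have [p pw] := delta_below w.
by exists p; split; apply: le_trans pw _.
Qed.

Lemma overlap_delta_inl x y : overlap (delta P x) (delta P y) <-> overlap x y.
Proof. exact: overlap_below. Qed.

Lemma overlap_delta_inr p (s : set_type (@new_index d P)) :
  overlap (delta P p) (inr s : G P) <-> val s p.
Proof.
have := set_valP s; case=> A _ As.
rewrite overlap_below; split=> [[q [qp /le_delta_inr qs]]|].
  have := qs q (overlap_refl q); rewrite -As => -[a Aa aq].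
  by exists a => //; apply: overlap_ler aq.
rewrite -As => -[a Aa [q [qa qp]]]; exists q; split=> //.
apply/le_delta_inr; rewrite -As => y qy; exists a => //.
exact: overlap_lel qy.
Qed.

(** An element [v] of [G P] overlaps [u] exactly when some element of [P] below
    [v] does, so the fusion property need only be tested against [P]. *)
Lemma fusion_of_trace S m : S !=set0 ->
  (forall p, overlap (delta P p) m <-> exists2 u, S u & overlap (delta P p) u) ->
  is_fusion S m.
Proof.
move=> S0 Sm; split=> // v; split=> [/overlap_below[p [pv pm]]|[u Su]].
  have [|u Su pu] := (Sm p).1; first by exists (delta P p).
  by exists u => //; apply: overlap_lel pu.
move=> /overlap_below[p [pv pu]]; apply: (overlap_lel pv).
by apply/Sm; exists u => //; exists (delta P p).
Qed.

Lemma fusion_complete_G : fusion_complete (G P).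
Proof.
move=> S [u0 Su0].
pose B := [set p | exists2 u, S u & delta P p <= u].
have B0 : B !=set0 by have [p pu] := delta_below u0; exists p, u0.
(* [O(B)] is the union of the traces of the members of [S]. *)
have SB p : overlaps_set B p <-> exists2 u, S u & overlap (delta P p) u.
  split=> [[q [u Su qu] qp]|[u Su /overlap_below[q [qp qu]]]].
    exists u => //; apply: overlap_ler qu _.
    by apply/overlap_delta_inl; apply: overlap_sym.
  by exists q; [exists u|exists q; split].
have [[x [_ Bx]]|nB] := pselect (exists x, is_fusion B x).
  exists (delta P x); apply: fusion_of_trace; first by exists u0.
  move=> p; rewrite overlap_delta_inl Bx -SB.
  by split=> -[z Bz pz]; exists z => //; apply: overlap_sym.
have newB : new_index (overlaps_set B) by exists B.
exists (inr (SigSub (mem_set newB))).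
apply: fusion_of_trace; first by exists u0.
move=> p; split=> [/overlap_delta_inr/SB //|/SB pB].
exact/overlap_delta_inr.
Qed.

Lemma fusion_preserving_delta : fusion_preserving (delta P).
Proof.
move=> A x [A0 Ax]; apply: fusion_of_trace; first exact: image_nonempty.
move=> p; rewrite overlap_delta_inl Ax; split=> [[z Az pz]|[_ [z Az <-]]].
  by exists (delta P z); [exists z|apply/overlap_delta_inl].
by move/overlap_delta_inl; exists z.
Qed.

Lemma fusion_dense_delta : fusion_dense (delta P).
Proof.
move=> m; exists [set p | delta P p <= m]; apply: fusion_of_trace.
  by have [p pm] := delta_below m; exists (delta P p), p.
move=> p; split=> [/overlap_below[q [qp qm]]|[_ [q qm <-]]].
  by exists (delta P q); [exists q|exists (delta P q); split].
exact: overlap_ler.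
Qed.

End Completion.

Theorem theorem6p5 (d : Order.disp_t) (P : porderType d) :
  fusion_completion (delta P).
Proof.
split.
- exact: fusion_complete_G.
- by move=> x y; rewrite le_delta.
- by move=> x y /overlap_delta_inl.
- exact: fusion_preserving_delta.
- exact: fusion_dense_delta.
Qed.
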